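(* Let $\mathbb P$ satisfy the standing assumption on the weights given in the context. Fix $\xi\in\mathrm{ri}\,\mathcal U$ with $\mathcal U_\xi=[\underline\xi,\overline\xi]$ such that $\underline\xi,\xi,\overline\xi\in\mathcal D$. Let $B=\{B(\omega,x,y)\}_{x,y\in\mathbb Z^2}$ be the Busemann function associated to $[\underline\xi,\overline\xi]$, i.e. the almost sure limit $B(\omega,x,y)=\lim_{n\to\infty}\big(G_{x,v_n}(\omega)-G_{y,v_n}(\omega)\big)$ described in the context. Then there exists an event $\Omega_0$ with $\mathbb P(\Omega_0)=1$ such that the following statements hold for each $\omega\in\Omega_0$. (i) Every up-right path $(x_k)_{k\ge0}$ such that $\omega_{x_k}=B(\omega,x_k,x_{k+1})$ for all $k\ge0$ is a semi-infinite geodesic. Such a path is called a Busemann geodesic for $B$. (ii) Every semi-infinite geodesic $(x_k)_{k\ge0}$ that satisfies $$\underline\xi\cdot e_1\le\varliminf_{n\to\infty}\frac{x_n\cdot e_1}{n}\le\varlimsup_{n\to\infty}\frac{x_n\cdot e_1}{n}\le\overline\xi\cdot e_1$$ is a Busemann geodesic for $B$. (iii) Let $v_n\in\mathbb Z_+^2$ be a sequence with $|v_n|_1\to\infty$ and $\underline\xi\cdot e_1\le\varliminf_{n\to\infty}\frac{v_n\cdot e_1}{|v_n|_1}\le\varlimsup_{n\to\infty}\frac{v_n\cdot e_1}{|v_n|_1}\le\overline\xi\cdot e_1$. Let $m\in\mathbb N$. Then there exists $n_0\in\mathbb N$ such that if $n\ge n_0$, then every geodesic $(x_k)_{0\le k\le|v_n|_1}$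 from $x_0=0$ to $v_n$ satisfies $B(\omega,x_i,x_{i+1})=\omega_{x_i}$ for all $i=0,1,\dots,m$.
   Context: Notation: $e_1=(1,0)$, $e_2=(0,1)$, $|x|_1=|x\cdot e_1|+|x\cdot e_2|$; $x\le y$ is meant coordinatewise. $\Omega=\mathbb R^{\mathbb Z^2}$ is the space of weight configurations $\omega=(\omega_x)_{x\in\mathbb Z^2}$. Standing assumption: $\mathbb P$ is a Borel probability measure on $\Omega$ under which $(\omega_x)_{x\in\mathbb Z^2}$ are i.i.d., $\mathbb E|\omega_0|^p<\infty$ for some $p>2$, $\mathrm{Var}(\omega_0)>0$, and $\mathbb P(\omega_0\ge c)=1$ for some finite constant $c$. An up-right path is a (finite or infinite) sequence $(x_k)$ in $\mathbb Z^2$ with $x_{k+1}-x_k\in\{e_1,e_2\}$. For $x\le y$ in $\mathbb Z^2$, $G_{x,y}=\max\sum_{k=0}^{n-1}\omega_{x_k}$, the maximum over up-right paths $x_0=x,\dots,x_n=y$, $n=|y-x|_1$. A maximizing path is a geodesic from $x$ to $y$. A semi-infinite geodesic is an infinite up-right path $(x_k)_{k\ge0}$ such that for all $0\le i<j$ the segment $(x_k)_{i\le k\le j}$ is a geodesic from $x_i$ to $x_j$. Shape function: $g_{\rm pp}:\mathbb R_+^2\to\mathbb R$ is the deterministic, continuous, concave, $1$-homogeneous function such that $\mathbb P$-a.s. $n^{-1}\max_{x\in\mathbb Z_+^2,|x|_1=n}|G_{0,x}-g_{\rm pp}(x)|\to0$. $\mathcal U=\{te_1+(1-t)e_2:t\in[0,1]\}$,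 $\mathrm{ri}\,\mathcal U=\{te_1+(1-t)e_2:t\in(0,1)\}$. $\mathcal D$ is the set of $\xi\in\mathrm{ri}\,\mathcal U$ at which $g_{\rm pp}$ is differentiable. For $\zeta\in\mathrm{ri}\,\mathcal U$ the one-sided gradient vectors are defined by $\nabla g_{\rm pp}(\zeta\pm)\cdot e_1=\lim_{\varepsilon\searrow0}\frac{g_{\rm pp}(\zeta\pm\varepsilon e_1)-g_{\rm pp}(\zeta)}{\pm\varepsilon}$ and $\nabla g_{\rm pp}(\zeta\pm)\cdot e_2=\lim_{\varepsilon\searrow0}\frac{g_{\rm pp}(\zeta\mp\varepsilon e_2)-g_{\rm pp}(\zeta)}{\mp\varepsilon}$. For $\xi\in\mathrm{ri}\,\mathcal U$, $\mathcal U_{\xi\pm}=\{\zeta\in\mathrm{ri}\,\mathcal U: g_{\rm pp}(\zeta)-g_{\rm pp}(\xi)=\nabla g_{\rm pp}(\xi\pm)\cdot(\zeta-\xi)\}$ and $\mathcal U_\xi=\mathcal U_{\xi-}\cup\mathcal U_{\xi+}=[\underline\xi,\overline\xi]$, a closed (possibly degenerate) segment with $\underline\xi\cdot e_1\le\overline\xi\cdot e_1$. Busemann function (known result): if $\underline\xi,\xi,\overline\xi\in\mathcal D$, there exist integrable random variables $\{B(x,y):x,y\in\mathbb Z^2\}$ and an event of full $\mathbb P$-probability on which, for every sequence $v_n\in\mathbb Z_+^2$ with $|v_n|_1\to\infty$ and $\underline\xi\cdot e_1\le\varliminf \frac{v_n\cdot e_1}{|v_n|_1}\le\varlimsup\frac{v_n\cdot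 e_1}{|v_n|_1}\le\overline\xi\cdot e_1$, one has $B(\omega,x,y)=\lim_{n\to\infty}(G_{x,v_n}(\omega)-G_{y,v_n}(\omega))$ for all $x,y\in\mathbb Z^2$. *)

(* Defs.v *)
From HB Require Import structures.
From mathcomp Require Import all_boot all_order all_algebra.
From mathcomp Require Import all_classical all_reals all_analysis.
From mathcomp Require Import zify.
Import Order.TTheory GRing.Theory Num.Theory.
Import numFieldNormedType.Exports.

Set Implicit Arguments.
Unset Strict Implicit.
Unset Printing Implicit Defensive.

Local Open Scope classical_set_scope.
Local Open Scope ring_scope.

Notation site := (int * int)%type.

Definition e1 {A : pzRingType} : A * A := (1, 0).
Definition e2 {A : pzRingType} : A * A := (0, 1).

Definition norm1 (x : site) : nat := (`|x.1| + `|x.2|)%N.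

Definition le_site (x y : site) : bool := (x.1 <= y.1) && (x.2 <= y.2).

(* R^(Z^2) with the Borel sigma-algebra of the product topology *)
Notation config R :=
  (g_sigma_algebraType (@open (prod_topology (fun _ : site => R)))).

Definition weight {R : realType} (w : config R) : site -> R := w.

Lemma measurable_weight {R : realType} (x : site) :
  measurable_fun setT (fun w : config R => weight w x).
Proof.
apply: (measurability _ (measurable_realfun.RGenOpens.measurableE R)).
move=> _ [_ [a [b ->]] <-]; rewrite setTI; apply: sub_sigma_algebra.
have pc : continuous (proj x : prod_topology (fun _ : site => R) -> R).
  exact: proj_continuous.
by apply: (proj1 (continuousP _) pc); exact: interval_open.
Qed.

Definition upright_step (x y : site) : Prop := y - x = e1 \/ y - x = e2.

(* A finite path from x to y has |y - x|_1 steps; it is represented by a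
   function on nat whose values beyond index |y - x|_1 are irrelevant. *)
Definition path_between (x y : site) (g : nat -> site) : Prop :=
  [/\ g 0%N = x,
      g (norm1 (y - x)) = y &
      forall k, (k < norm1 (y - x)%R)%N -> upright_step (g k) (g k.+1)].

Definition infinite_path (g : nat -> site) : Prop :=
  forall k, upright_step (g k) (g k.+1).

(* the weight of the final point is not counted *)
Definition path_weight {R : realType} (w : config R) (n : nat)
    (g : nat -> site) : R :=
  \sum_(k < n) weight w (g k).

(* This supremum is a maximum when x <= y, see lpp_attained; otherwise there is
   no path from x to y and lpp w x y = 0 is a junk value. *)
Definition lpp {R : realType} (w : config R) (x y : site) : R :=
  sup [set path_weight w (norm1 (y - x)) g | g in path_between x y].

Definition geodesic {R : realType} (w : config R) (x y : site)
    (g : nat -> site) : Prop :=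
  path_between x y g /\ path_weight w (norm1 (y - x)) g = lpp w x y.

Lemma finite_path_weights {R : realType} (w : config R) (n : nat) (x y : site) :
  finite_set [set path_weight w n g | g in
    [set g | [/\ g 0%N = x, g n = y &
                forall k, (k < n)%N -> upright_step (g k) (g k.+1)]]].
Proof.
elim: n x => [|n IH] x.
  apply: (@sub_finite_set _ _ [set 0]) => // _ [g _ <-].
  by rewrite /path_weight big_ord0.
pose S z := [set path_weight w n g | g in
    [set g | [/\ g 0%N = z, g n = y &
                forall k, (k < n)%N -> upright_step (g k) (g k.+1)]]].
apply: (@sub_finite_set _ _
    ((fun r => weight w x + r) @` (S (x + e1) `|` S (x + e2)))).
  move=> _ [g [g0 gn gs] <-]; exists (path_weight w n (fun k => g k.+1)).
    have /= := gs 0%N isT; rewrite /upright_step g0.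
    case=> /eqP; rewrite subr_eq addrC => /eqP e; [left|right];
      by exists (fun k => g k.+1) => //; split => // k kn; apply: gs.
  by rewrite /path_weight big_ord_recl g0.
by apply: finite_image; rewrite finite_setU; split; exact: IH.
Qed.

Lemma path_between_ex (x y : site) : le_site x y -> exists g, path_between x y g.
Proof.
case: x y => [a b] [c d] /andP[/= ac bd].
exists (fun k => (a + (minn k `|c - a|)%:Z, b + (k - `|c - a|)%N%:Z)).
rewrite /path_between /norm1 /upright_step /=; split.
- by congr pair; lia.
- by congr pair; lia.
- move=> k /= hk; have [kl|kl] := ltnP k `|c - a|; [left|right];
  apply/eqP; rewrite xpair_eqE /=; apply/andP; split; apply/eqP=> /=; lia.
Qed.

Lemma lpp_attained {R : realType} (w : config R) (x y : site) :
  le_site x y ->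
  (exists g, geodesic w x y g) /\
  forall h, path_between x y h -> path_weight w (norm1 (y - x)) h <= lpp w x y.
Proof.
move=> /path_between_ex [g0 hg0].
have fS := finite_path_weights w (norm1 (y - x)) x y.
rewrite /geodesic /lpp; set S := [set _ | _ in path_between x y].
have {}fS : finite_set S by apply: fS.
have S0 : S !=set0 by exists (path_weight w (norm1 (y - x)) g0); exists g0.
have hub : has_ubound S.
  have [s Ss] := proj1 (finite_seqP _) fS.
  exists (\sum_(r <- s) `|r|) => r; rewrite Ss /= => rs.
  by rewrite (big_rem r rs) /= (le_trans (ler_norm r))// lerDl sumr_ge0.
have hS h : path_between x y h -> path_weight w (norm1 (y - x)) h <= sup S.
  by move=> hh; apply: ub_le_sup => //; exists h.
split=> //.
suff : S (sup S) by move=> [h hh e]; exists h.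
have : closed S.
  apply: (proj1 (@accessible_finite_set_closed R)) => //.
  exact/hausdorff_accessible/Rhausdorff.
by move=> /closure_id cS; rewrite [X in X _]cS; exact: closure_sup.
Qed.

Definition semi_infinite_geodesic {R : realType} (w : config R)
    (g : nat -> site) : Prop :=
  infinite_path g /\
  forall i j, (i < j)%N -> geodesic w (g i) (g j) (fun k => g (i + k)%N).

Definition independent_weights {R : realType} (P : probability (config R) R) :=
  forall (s : seq site) (A : site -> set R),
    uniq s -> (forall x, measurable (A x)) ->
    P [set w | forall x, x \in s -> A x (weight w x)] =
    (\prod_(x <- s) P [set w | A x (weight w x)])%E.

Definition identically_distributed_weights {R : realType}
    (P : probability (config R) R) :=
  forall (x : site) (A : set R), measurable A ->
    P [set w | A (weight w x)] = P [set w | A (weight w 0)].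

Record standing_assumption {R : realType} (P : probability (config R) R) :
    Prop := StandingAssumption {
  sa_independent : independent_weights P;
  sa_identically_distributed : identically_distributed_weights P;
  sa_moment : exists2 p : R,
    2 < p & ('E_P[(fun w => `|weight w 0| `^ p)%R] < +oo)%E;
  sa_variance : (0 < 'V_P[(fun w => weight w 0)%R])%E;
  sa_bounded_below : exists c : R, P [set w | c <= weight w 0] = 1%E
}.

Definition quadrant {R : realType} : set (R * R) :=
  [set a | 0 <= a.1 /\ 0 <= a.2].

(* The points x of Z_+^2 with |x|_1 = n are enumerated as (i, n - i),
   0 <= i <= n.  Values of g outside the quadrant are irrelevant. *)
Record shape_function {R : realType} (P : probability (config R) R)
    (g : R * R -> R) : Prop := ShapeFunction {
  shape_continuous : {within quadrant, continuous g};
  shape_concave : forall (a b : R * R) (t : R),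
    quadrant a -> quadrant b -> 0 <= t <= 1 ->
    t * g a + (1 - t) * g b <= g (t *: a + (1 - t) *: b);
  shape_homogeneous : forall (a : R * R) (c : R),
    quadrant a -> 0 <= c -> g (c *: a) = c * g a;
  shape_limit : {ae P, forall w,
    n%:R^-1 * \big[Num.max/0]_(i < n.+1)
       `|lpp w 0 (i%:Z, (n - i)%N%:Z) - g (i%:R, (n - i)%:R)|
      @[n --> \oo] --> (0 : R)}
}.

Definition riU {R : realType} : set (R * R) :=
  [set t *: e1 + (1 - t) *: e2 | t in `]0, 1[].

Definition differentiability_directions {R : realType} (g : R * R -> R) :
    set (R * R) :=
  [set z | riU z /\ differentiable (g : R * R -> R^o) z].

(* s = 1 gives the gradient at z+, s = -1 the gradient at z-; the two
   coordinates are differentiated from opposite sides. *)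
Definition onesided_gradient {R : realType} (g : R * R -> R) (z : R * R)
    (s : R) : R * R :=
  (lim ((g (z + (s * h) *: e1) - g z) / (s * h) @[h --> 0^'+]),
   lim ((g (z - (s * h) *: e2) - g z) / (- (s * h)) @[h --> 0^'+])).

Definition dot {R : realType} (a b : R * R) : R := a.1 * b.1 + a.2 * b.2.

Definition linear_piece {R : realType} (g : R * R -> R) (xi : R * R) (s : R) :
    set (R * R) :=
  [set z | riU z /\ g z - g xi = dot (onesided_gradient g xi s) (z - xi)].

Definition linear_segment {R : realType} (g : R * R -> R) (xi : R * R) :
    set (R * R) :=
  linear_piece g xi (-1) `|` linear_piece g xi 1.

Definition closed_segment {R : realType} (a b : R * R) : set (R * R) :=
  [set (1 - t) *: a + t *: b | t in `[0, 1]].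

Definition directed_into {R : realType} (xl xr : R * R) (u : nat -> R) : Prop :=
  (xl.1%:E <= limn_einf (EFin \o u))%E /\
  (limn_esup (EFin \o u) <= xr.1%:E)%E.

Definition admissible_sequence {R : realType} (xl xr : R * R)
    (v : nat -> site) : Prop :=
  [/\ forall n, le_site 0 (v n),
      norm1 (v n) @[n --> \oo] --> \oo &
      directed_into xl xr (fun n => (v n).1%:~R / (norm1 (v n))%:R)].

(* B w x y stands for B(w, x, y); integrability includes measurability *)
Record busemann_function {R : realType} (P : probability (config R) R)
    (xl xr : R * R) (B : config R -> site -> site -> R) : Prop :=
  BusemannFunction {
  busemann_integrable : forall x y,
    P.-integrable setT (fun w => (B w x y)%:E);
  busemann_limit : {ae P, forall w, forall v, admissible_sequence xl xr v ->
    forall x y, lpp w x (v n) - lpp w y (v n) @[n --> \oo] --> B w x y}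
}.

Definition busemann_geodesic {R : realType}
    (B : config R -> site -> site -> R) (w : config R) (g : nat -> site) :
    Prop :=
  infinite_path g /\ forall k, weight w (g k) = B w (g k) (g k.+1).

(* Main.v *)
Require Import Defs.
From HB Require Import structures.
From mathcomp Require Import all_boot all_order all_algebra.
From mathcomp Require Import all_classical all_reals all_analysis.
From mathcomp Require Import zify lra.
Import Order.TTheory GRing.Theory Num.Theory.
Import numFieldNormedType.Exports.

Local Open Scope classical_set_scope.
Local Open Scope ring_scope.

(** All three conclusions hold on the single almost sure event on which
    [lpp w x (v n) - lpp w y (v n)] converges to [B w x y] along every
    admissible sequence; from there on the argument is deterministic, with [w]
    fixed.  It rests on the dynamic programming structure of last-passage times.
    For a step from x to y and an endpoint v beyond y one has
    [weight w x + lpp w y v <= lpp w x v] ([lpp_upright_step]), because a path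
    from y can be prolonged backwards to x, and equality holds whenever a
    geodesic from x to v takes that step ([geodesic_increment]).

    Passing to the limit along one admissible sequence turns the inequality into
    [weight w x <= B w x y] on steps ([weight_le_busemann]), and the difference
    structure into the cocycle property [B x y + B y z = B x z]
    ([busemann_cocycle]).  Hence B telescopes along paths: every path from x to
    y has weight at most [B w x y], with equality along a path of the Busemann
    kind, which is therefore a geodesic.  This is (i).

    For (ii), a directed semi-infinite geodesic is itself, up to finitely many
    terms, an admissible sequence, and along its own points the increment
    [lpp w (g k) (g n) - lpp w (g k.+1) (g n)] is constantly [weight w (g k)],
    so that its limit B has this value.

    For (iii), if [B w x y] differs from [weight w x] then the increment towards
    [v n] differs from [weight w x] for all large n, so geodesics to [v n]
    eventually avoid the step from x to y.  The first m + 1 steps of a geodesic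
    from the origin lie in a finite box, so one threshold serves all of them.

    The geometry enters only through the differentiability directions [xl] and
    [xr] lying strictly inside the segment U: both coordinates of an admissible
    sequence then tend to infinity ([directed_coords_dvg]), so each fixed site
    is eventually below [v n], and the last-passage times in the limit are
    genuine maxima rather than the default value of the supremum of an empty
    set. *)

(** * Up-right paths and dynamic programming *)

Section Paths.
Context {R : realType}.
Set Implicit Arguments.
Unset Strict Implicit.
Implicit Types (w : config R) (x y v : site) (g : nat -> site).

Lemma upright_step_coords x y : upright_step x y ->
  (y.1 = x.1 + 1 /\ y.2 = x.2) \/ (y.1 = x.1 /\ y.2 = x.2 + 1).
Proof.
case: x y => [a b] [c d]; case=> -[/= h1 h2]; [left|right]; split; lia.
Qed.

(** Each step raises the height x.1 + x.2 by one and decreases no coordinate;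
    hence the time along a path is the l1 distance from its start. *)
Lemma upright_prefix_coords g n :
  (forall k, (k < n)%N -> upright_step (g k) (g k.+1)) ->
  forall k, (k <= n)%N ->
    le_site (g 0%N) (g k) /\ norm1 (g k - g 0%N) = k.
Proof.
move=> gs; elim=> [|k IH] kn; first by rewrite subrr /le_site !lexx.
have [] := IH (ltnW kn); have := upright_step_coords (gs k kn).
move: (g 0%N) (g k) (g k.+1) => [a b] [c d] [e f].
rewrite /le_site /norm1 /= => h /andP[h1 h2] h3; split; [apply/andP; split|];
  lia.
Qed.

Lemma path_between_le x v g : path_between x v g -> le_site x v.
Proof.
by move=> [g0 gn /upright_prefix_coords/(_ _ (leqnn _))[]]; rewrite g0 gn.
Qed.

Lemma infinite_path_segment g i j : infinite_path g -> (i <= j)%N ->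
  norm1 (g j - g i) = (j - i)%N /\
  path_between (g i) (g j) (fun k => g (i + k)%N).
Proof.
move=> gp ij; have gs k : (k < j - i)%N ->
  upright_step (g (i + k)%N) (g (i + k.+1)%N) by rewrite addnS => _; apply: gp.
have [_] := upright_prefix_coords gs (leqnn _); rewrite addn0 subnKC// => e.
by split=> //; split=> [|//|//]; rewrite ?addn0 ?e ?subnKC.
Qed.

Lemma norm1_upright_step x y v : upright_step x y -> le_site y v ->
  norm1 (v - x) = (norm1 (v - y)).+1.
Proof.
move/upright_step_coords; case: x y v => [a b] [c d] [e f].
by rewrite /le_site /norm1 /= => h /andP[h1 h2]; lia.
Qed.

(** Prepending x to a geodesic from y to v gives a path competing for
    [lpp w x v]. *)
Lemma lpp_upright_step w x y v : upright_step x y -> le_site y v ->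
  weight w x + lpp w y v <= lpp w x v.
Proof.
move=> xy yv; have nE := norm1_upright_step xy yv.
have [[h [[h0 hn hs] <-]] _] := lpp_attained w yv.
pose g k := if k is k'.+1 then h k' else x.
have gp : path_between x v g.
  split=> //; first by rewrite nE.
  by rewrite nE => -[|k] /= kn; [rewrite h0|apply: hs].
have [_ /(_ g gp)] := lpp_attained w (path_between_le gp).
by rewrite nE /path_weight big_ord_recl.
Qed.

(** The weight of the tail is at most [lpp w (g 1) v], while
    [lpp_upright_step] gives the reverse inequality since the whole path attains
    [lpp w x v]; so the tail is a geodesic and the step inequality is tight. *)
Lemma geodesic_behead w x v g : (0 < norm1 (v - x)%R)%N -> geodesic w x v g ->
  [/\ norm1 (v - x) = (norm1 (v - g 1%N)).+1,
      lpp w x v = weight w x + lpp w (g 1%N) v &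
      geodesic w (g 1%N) v (fun k => g k.+1)].
Proof.
move=> n0 [[g0 gn gs] gw].
have le1 : le_site (g 1%N) v.
  have gs' k : (k < (norm1 (v - x)%R).-1)%N ->
    upright_step (g k.+1) (g k.+2) by move=> kn; apply: gs; lia.
  by have [+ _] := @upright_prefix_coords (g \o S) _ gs' _ (leqnn _);
    rewrite /= prednK// gn.
have st : upright_step x (g 1%N) by rewrite -g0; exact: gs.
have nE := norm1_upright_step st le1.
have gp : path_between (g 1%N) v (fun k => g k.+1).
  by split=> [//||k kn]; [rewrite -nE|apply: gs; rewrite nE].
have [_ /(_ _ gp) le2] := lpp_attained w le1.
have := lpp_upright_step w st le1.
rewrite -gw nE /path_weight big_ord_recl g0 lerD2l => ge2.
have e : \sum_(i < norm1 (v - g 1%N)) weight w (g i.+1) = lpp w (g 1%N) v.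
  by apply/eqP; rewrite eq_le -{1}/(path_weight w _ (fun k => g k.+1)) le2.
by split=> //; rewrite -e.
Qed.

(** The increment of the last-passage time towards the endpoint v along a
    geodesic reads off the weight: this identity survives in the limit where v
    goes to infinity. *)
Lemma geodesic_increment w x v g k : geodesic w x v g ->
  (k < norm1 (v - x)%R)%N ->
  lpp w (g k) v - lpp w (g k.+1) v = weight w (g k).
Proof.
elim: k x g => [|k IH] x g gg kn; have n0 := leq_ltn_trans (leq0n _) kn.
  have [_ + _] := geodesic_behead n0 gg; have [[-> _ _] _] := gg.
  by move=> ->; rewrite addrK.
have [nE _ gg'] := geodesic_behead n0 gg.
by apply: (IH _ _ gg'); rewrite nE in kn.
Qed.

End Paths.

(** * Asymptotic directions *)

Section Directions.
Context {R : realType}.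
Set Implicit Arguments.
Unset Strict Implicit.
Implicit Types (u : nat -> R) (v : nat -> site).

Lemma limn_esup_leP u (r : R) : (limn_esup (EFin \o u) <= r%:E)%E <->
  forall e, 0 < e -> \forall n \near \oo, u n <= r + e.
Proof.
split=> [h e e0|h].
  have : (limn_esup (EFin \o u) < (r + e)%:E)%E.
    by rewrite (le_lt_trans h)// lte_fin ltrDl.
  move=> /ereal_inf_lt[_ [V VF <-] lt].
  apply: filterS VF => n Vn; rewrite -lee_fin (le_trans _ (ltW lt))//.
  by apply: ereal_sup_ubound; exists n.
apply/lee_addgt0Pr => e e0; apply: (@le_trans _ _ (ereal_sup
    ((EFin \o u) @` [set n | u n <= r + e]%R))).
  by apply: ereal_inf_lbound; exists [set n | u n <= r + e] => //; exact: h.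
by apply: ge_ereal_sup => _ [n /= un <-]; rewrite -EFinD lee_fin.
Qed.

Lemma limn_einf_geP u (r : R) : (r%:E <= limn_einf (EFin \o u))%E <->
  forall e, 0 < e -> \forall n \near \oo, r - e <= u n.
Proof.
have -> : (r%:E <= limn_einf (EFin \o u))%E =
    (limn_esup (EFin \o (fun n => - u n)%R) <= (- r)%:E)%E.
  by rewrite -[X in limn_esup X]/(-%E \o (EFin \o u)) limn_esupN EFinN leeN2.
by rewrite limn_esup_leP; split=> h e e0; apply: filterS (h e e0) => n; lra.
Qed.

(** The lim inf and lim sup are extended-real valued; this form in terms of
    eventual bounds allows real arithmetic on the terms of the sequence. *)
Lemma directed_intoP (xl xr : R * R) u : directed_into xl xr u <->
  forall e, 0 < e -> \forall n \near \oo, xl.1 - e <= u n <= xr.1 + e.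
Proof.
rewrite /directed_into limn_einf_geP limn_esup_leP.
split=> [[h1 h2] e e0|h].
  by near=> n; apply/andP; split; near: n; [exact: h1|exact: h2].
by split=> e /h; apply: filterS => n /andP[].
Unshelve. all: by end_near. Qed.

Lemma cvg_nat_gt (s : nat -> nat) (A : R) : s n @[n --> \oo] --> \oo ->
  \forall n \near \oo, A < (s n)%:R.
Proof.
move=> /cvgnyPge/(_ (Num.bound A)); apply: filterS => n h.
have [A0|A0] := ltP A 0; first exact: lt_le_trans A0 (ler0n _ _).
by rewrite (lt_le_trans (archi_boundP A0))// ler_nat.
Qed.

(** If the slopes stay away from 0 and 1 then both coordinates grow linearly
    with s.  The offset c allows one statement for sequences starting at the
    origin (s the l1 norm, c = 0) and for paths from an arbitrary site (s the
    number of steps, c the height of the initial site). *)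
Lemma directed_coords_dvg {xl xr : R * R} {v} {s : nat -> nat} {c : int} :
  0 < xl.1 -> xr.1 < 1 -> s n @[n --> \oo] --> \oo ->
  (forall n, (v n).1 + (v n).2 = (s n)%:Z + c) ->
  directed_into xl xr (fun n => (v n).1%:~R / (s n)%:R) ->
  forall x : site, \forall n \near \oo, le_site x (v n).
Proof.
move=> l0 r1 soo sE /directed_intoP dv x.
(* with this e the slopes eventually lie in [e, 1 - e] *)
pose e := Num.min xl.1 (1 - xr.1) / 2.
have e0 : 0 < e by rewrite divr_gt0// lt_min l0 subr_gt0.
have e2 : e + e = Num.min xl.1 (1 - xr.1) by rewrite -splitr.
have [el' er'] : e + e <= xl.1 /\ e + e <= 1 - xr.1.
  by rewrite e2 !ge_min !lexx orbT.
have el : e <= xl.1 - e by lra.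
have er : xr.1 + e <= 1 - e by lra.
near=> n.
have s0 : 0 < (s n)%:R :> R by near: n; exact: cvg_nat_gt.
have /andP[] : xl.1 - e <= (v n).1%:~R / (s n)%:R <= xr.1 + e.
  by near: n; exact: dv.
rewrite ler_pdivlMr// ler_pdivrMr// => hl hr.
have big : (`|x.1%:~R| + `|x.2%:~R| + `|c%:~R|) / e < (s n)%:R :> R.
  by near: n; exact: cvg_nat_gt.
rewrite ltr_pdivrMr// in big.
have /(congr1 (fun z : int => z%:~R : R)) := sE n; rewrite !intrD => hE.
have n1 := ler_norm (x.1%:~R : R); have n2 := ler_norm (x.2%:~R : R).
have n3 := ler_norm (- c%:~R : R); rewrite normrN in n3.
have m1 := ler_wpM2r (ltW s0) el; have m2 := ler_wpM2r (ltW s0) er.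
have p1 := normr_ge0 (x.1%:~R : R); have p2 := normr_ge0 (x.2%:~R : R).
have p3 := normr_ge0 (c%:~R : R).
by rewrite /le_site -!(ler_int R); apply/andP; split; nra.
Unshelve. all: by end_near. Qed.

(** Changing the denominator by a bounded amount does not affect the
    asymptotic direction.  This reconciles the division by the number of steps
    for paths with the division by the l1 norm for endpoints. *)
Lemma directed_into_height {xl xr : R * R} {v} {s t : nat -> nat} {c : int} :
  s n @[n --> \oo] --> \oo -> t n @[n --> \oo] --> \oo ->
  (forall n, (t n)%:Z = (s n)%:Z + c) ->
  directed_into xl xr (fun n => (v n).1%:~R / (s n)%:R) ->
  directed_into xl xr (fun n => (v n).1%:~R / (t n)%:R).
Proof.
move=> soo too tE /directed_intoP dv; apply/directed_intoP => e e0.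
have e20 : 0 < e / 2 by rewrite divr_gt0.
near=> n.
have s0 : 0 < (s n)%:R :> R by near: n; exact: cvg_nat_gt.
have t0 : 0 < (t n)%:R :> R by near: n; exact: cvg_nat_gt.
have /andP[] : xl.1 - e / 2 <= (v n).1%:~R / (s n)%:R <= xr.1 + e / 2.
  by near: n; exact: dv.
rewrite ler_pdivlMr// ler_pdivrMr// => hl hr.
have big : (`|(xl.1 - e) * c%:~R| + `|(xr.1 + e) * c%:~R|) / (e / 2) < (s n)%:R.
  by near: n; exact: cvg_nat_gt.
rewrite ltr_pdivrMr// in big.
have /(congr1 (fun z : int => z%:~R : R)) := tE n.
rewrite intrD => hE.
have n1 := ler_norm ((xl.1 - e) * c%:~R).
have n2 := ler_norm (- ((xr.1 + e) * c%:~R)); rewrite normrN in n2.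
have p1 := normr_ge0 ((xl.1 - e) * c%:~R).
have p2 := normr_ge0 ((xr.1 + e) * c%:~R).
rewrite -!pmulrn in hE.
by rewrite ler_pdivlMr// ler_pdivrMr// hE; apply/andP; split; nra.
Unshelve. all: by end_near. Qed.

End Directions.

(** * Deterministic consequences of the Busemann limits *)

Section Busemann.
Context {R : realType} (w : config R) (xl xr : R * R) (b : site -> site -> R).
Context (l0 : 0 < xl.1) (lr : xl.1 <= xr.1) (r1 : xr.1 < 1).
Context (hb : forall v, admissible_sequence xl xr v ->
  forall x y, lpp w x (v n) - lpp w y (v n) @[n --> \oo] --> b x y).
Set Implicit Arguments.
Unset Strict Implicit.
Implicit Types (x y : site) (v g : nat -> site).

Lemma admissible_exceeds v : admissible_sequence xl xr v ->
  forall x, \forall n \near \oo, le_site x (v n).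
Proof.
move=> [v0 voo dv]; apply: (directed_coords_dvg (c := 0) l0 r1 voo _ dv) => n.
by have /andP[] := v0 n; rewrite /norm1 /=; lia.
Qed.

(** Without an admissible sequence the hypothesis on the limits would say
    nothing about b.  The witness follows the ray of slope xl.1. *)
Lemma admissible_exists : exists v, admissible_sequence xl xr v.
Proof.
pose f n := Num.floor (xl.1 * n%:R).
have fP n : (f n)%:~R <= xl.1 * n%:R < (f n)%:~R + 1.
  by have := floor_itv (xl.1 * n%:R); rewrite intrD.
have f0 n : 0 <= f n by rewrite floor_ge0 mulr_ge0// ltW.
have fn n : f n <= n%:Z.
  rewrite -(ler_int R); have /andP[+ _] := fP n; move/le_trans; apply.
  by rewrite ler_piMl// ltW// (le_lt_trans lr).
have nE n : norm1 (f n, n%:Z - f n) = n.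
  by have := f0 n; have := fn n; rewrite /norm1 /=; lia.
exists (fun n => (f n, n%:Z - f n)); split.
- by move=> n; rewrite /le_site /= f0 subr_ge0 fn.
- by under eq_fun do rewrite nE; exact: cvg_id.
apply/directed_intoP => e e0; near=> n.
have n0 : 0 < n%:R :> R by near: n; exact: (@cvg_nat_gt _ id 0 cvg_id).
have ne : e^-1 < n%:R by near: n; exact: (@cvg_nat_gt _ id _ cvg_id).
rewrite /= nE ler_pdivlMr// ler_pdivrMr//.
have /andP[h1 h2] := fP n.
have h3 : 1 < e * n%:R.
  by rewrite -ltr_pdivrMl// mulr1.
by have h4 := ler_wpM2r (ltW n0) lr; apply/andP; split; nra.
Unshelve. all: by end_near. Qed.

Lemma busemann_cocycle x y z : b x y + b y z = b x z.
Proof.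
have [v /hb hv] := admissible_exists.
have h : lpp w x (v n) - lpp w z (v n) @[n --> \oo] --> b x y + b y z.
  under eq_fun => n do rewrite -(subrKA (lpp w y (v n))).
  exact: cvgD (hv x y) (hv y z).
exact: (cvg_unique _ h (hv x z)).
Qed.

Lemma busemann_refl x : b x x = 0.
Proof. by apply: (@addrI _ (b x x)); rewrite busemann_cocycle addr0. Qed.

(** The limit of [lpp_upright_step], valid along an admissible sequence once it
    has passed y. *)
Lemma weight_le_busemann x y : upright_step x y -> weight w x <= b x y.
Proof.
move=> xy; have [v va] := admissible_exists.
apply: (cvgr_to_ge (@hb v va x y)); near=> n.
rewrite lerBrDr; apply: lpp_upright_step => //.
by near: n; exact: admissible_exceeds.
Unshelve. all: by end_near. Qed.

Lemma path_weight_le_busemann n g :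
  (forall k, (k < n)%N -> upright_step (g k) (g k.+1)) ->
  path_weight w n g <= b (g 0%N) (g n).
Proof.
elim: n => [|n IH] gs.
  by rewrite busemann_refl /path_weight big_ord0.
rewrite -(busemann_cocycle _ (g n)) /path_weight big_ord_recr lerD//.
  by apply: IH => k kn; apply: gs; rewrite ltnS ltnW.
exact/weight_le_busemann/gs.
Qed.

Lemma busemann_path_weight n g :
  (forall k, (k < n)%N -> weight w (g k) = b (g k) (g k.+1)) ->
  path_weight w n g = b (g 0%N) (g n).
Proof.
elim: n => [|n IH] gs.
  by rewrite busemann_refl /path_weight big_ord0.
rewrite -(busemann_cocycle _ (g n)) -gs//.
by rewrite /path_weight big_ord_recr; congr (_ + _); apply: IH => k /ltnW/gs.
Qed.

(** Between two of its points g attains the upper bound that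
    [path_weight_le_busemann] imposes on every competing path. *)
Lemma busemann_geodesic_semi_infinite g : infinite_path g ->
  (forall k, weight w (g k) = b (g k) (g k.+1)) -> semi_infinite_geodesic w g.
Proof.
move=> gp gw; split=> // i j /ltnW ij.
have [nE ijp] := infinite_path_segment gp ij; split=> //.
have [[h [[h0 hn hs] hl]] hle] := lpp_attained w (path_between_le ijp).
apply/eqP; rewrite eq_le hle//= -hl.
rewrite [leRHS]busemann_path_weight => [|k _]; last by rewrite addnS.
have := path_weight_le_busemann hs.
by rewrite h0 hn nE addn0 subnKC.
Qed.

(** The geodesic serves as its own admissible sequence of endpoints.  It may
    start anywhere in the lattice, so its points before it enters the positive
    quadrant are dropped. *)
Lemma semi_infinite_geodesic_busemann g : semi_infinite_geodesic w g ->
  directed_into xl xr (fun n => (g n).1%:~R / n%:R) ->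
  forall k, weight w (g k) = b (g k) (g k.+1).
Proof.
move=> [gp gg] gd k.
have gs := fun n => infinite_path_segment gp (leq0n n).
have gh n : (g n).1 + (g n).2 = n%:Z + ((g 0%N).1 + (g 0%N).2).
  have [nE /path_between_le/andP[]] := gs n.
  by move: nE; rewrite /norm1 /=; lia.
have [N _ gN] := directed_coords_dvg l0 r1 cvg_id gh gd 0.
have normE n : (N <= n)%N ->
    (norm1 (g n))%:Z = n%:Z + ((g 0%N).1 + (g 0%N).2).
  move=> Nn; rewrite -gh; have /andP[] := gN _ Nn.
  by rewrite /norm1 /=; lia.
(* N is a time after which the path stays in the positive quadrant *)
pose v n := g (n + N)%N.
have va : admissible_sequence xl xr v.
  have voo : norm1 (v n) @[n --> \oo] --> \oo.
    apply/cvgnyPge => A.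
    exists (absz ((g 0%N).1 + (g 0%N).2)%R + A)%N => // n /= An.
    by have := normE (n + N)%N (leq_addl _ _); rewrite /v; lia.
  split=> //; first by move=> n; apply: gN; rewrite /= leq_addl.
  apply: (directed_into_height (cvg_addnr N) voo).
    by move=> n; apply: normE; exact: leq_addl.
  apply/directed_intoP => e e0; move/directed_intoP : gd => /(_ e e0).
  by move=> /(cvg_addnr N).
suff cst : lpp w (g k) (v n) - lpp w (g k.+1) (v n) @[n --> \oo] -->
    weight w (g k) by exact: cvg_unique _ cst (@hb v va _ _).
apply: cvg_near_cst; exists k.+1 => // n /= kn.
have kN : (k < n + N)%N by lia.
have [nE _] := infinite_path_segment gp (ltnW kN).
have := geodesic_increment (k := 0%N) (gg _ _ kN).
by rewrite addn0 addn1 nE; apply; lia.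
Qed.

(** A step with [b x y <> weight w x] cannot be used by geodesics to [v n] for
    large n; the threshold depends on the step, and is made uniform by
    confining the first m + 1 steps to a finite box. *)
Lemma geodesic_prefix_busemann v m : admissible_sequence xl xr v ->
  \forall n \near \oo, forall g, geodesic w 0 (v n) g ->
    forall i, (i <= m)%N -> b (g i) (g i.+1) = weight w (g i).
Proof.
(* keeps lia from capturing the bounds on the slopes in the proof term *)
clear l0 lr r1; move=> va; have [_ voo _] := va.
have stable x y : \forall n \near \oo,
    lpp w x (v n) - lpp w y (v n) = weight w x -> b x y = weight w x.
  have [bw|bw] := eqVneq (b x y) (weight w x); first exact: nearW.
  have : lpp w x (v n) - lpp w y (v n) - weight w x @[n --> \oo] -->
      b x y - weight w x by apply: cvgB; [exact: hb|exact: cvg_cst].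
  move=> /cvgr_neq0; rewrite subr_eq0 => /(_ bw); apply: filterS => n.
  by rewrite subr_eq0 => /eqP.
(* m + 1 steps are involved, so coordinates range over 0, ..., m + 1 *)
pose pt (p : 'I_m.+2 * 'I_m.+2) : site := (p.1%:Z, p.2%:Z).
have box : \forall n \near \oo, forall p q : 'I_m.+2 * 'I_m.+2,
    lpp w (pt p) (v n) - lpp w (pt q) (v n) = weight w (pt p) ->
    b (pt p) (pt q) = weight w (pt p).
  by do 2!apply: filter_forall => ?; exact: stable.
have long : \forall n \near \oo, (m < norm1 (v n))%N.
  by move/cvgnyPge : voo; exact.
apply: filterS2 box long => n boxn; move=> mn g gg i im.
rewrite -[v n]subr0 in mn.
have [[g0 gn gs] _] := gg.
have inbox k : (k <= m.+1)%N -> exists p, g k = pt p.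
  move=> km; have [] := upright_prefix_coords gs (leq_trans km mn).
  rewrite g0 subr0; case: (g k) => a c /andP[/= a0 c0]; rewrite /norm1 /= => e.
  have am : (`|a| < m.+2)%N by lia.
  have cm : (`|c| < m.+2)%N by lia.
  by exists (Ordinal am, Ordinal cm); rewrite /pt /= !gez0_abs.
have [p pE] := inbox i (leqW im); have [q qE] := inbox i.+1 im.
have := geodesic_increment gg (leq_ltn_trans im mn).
by rewrite pE qE; exact: boxn.
Qed.

End Busemann.

(** * The theorem *)

Theorem theorem2p4 (R : realType) (P : probability (config R) R)
    (hP : standing_assumption P)
    (gpp : R * R -> R) (hg : shape_function P gpp)
    (xi xl xr : R * R)
    (hxi : riU xi)
    (hU : linear_segment gpp xi = closed_segment xl xr)
    (hlr : xl.1 <= xr.1)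
    (hDl : differentiability_directions gpp xl)
    (hDxi : differentiability_directions gpp xi)
    (hDr : differentiability_directions gpp xr)
    (B : config R -> site -> site -> R)
    (hB : busemann_function P xl xr B) :
  exists Omega0 : set (config R),
    [/\ measurable Omega0, P Omega0 = 1%E &
    forall w, Omega0 w ->
    [/\ (forall x : nat -> site,
           busemann_geodesic B w x -> semi_infinite_geodesic w x),
        (forall x : nat -> site,
           semi_infinite_geodesic w x ->
           directed_into xl xr (fun n => (x n).1%:~R / n%:R) ->
           busemann_geodesic B w x) &
        (forall (v : nat -> site) (m : nat),
           admissible_sequence xl xr v ->
           exists n0 : nat, forall n, (n0 <= n)%N ->
             forall x : nat -> site, geodesic w 0 (v n) x ->
               forall i, (i <= m)%N ->
                 B w (x i) (x i.+1) = weight w (x i))]].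
Proof.
have riU1 (z : R * R) : riU z -> 0 < z.1 < 1.
  by case=> t /=; rewrite in_itv /= => t01 <-;
  rewrite -[X in 0 < X < 1]/(t * 1 + (1 - t) * 0) mulr1 mulr0 addr0.
(* differentiability directions lie in the relative interior of U, which
   keeps both slopes away from the axes *)
have /andP[l0 _] := riU1 _ (proj1 hDl); have /andP[_ r1] := riU1 _ (proj1 hDr).
have [N [mN N0 limN]] := busemann_limit hB.
exists (~` N); split; first exact: measurableC.
  by rewrite probability_setC// N0 sube0.
move=> w Nw.
have hb v : admissible_sequence xl xr v ->
    forall x y, lpp w x (v n) - lpp w y (v n) @[n --> \oo] --> B w x y.
  by apply: contra_notP Nw => nh; apply: limN => /(_ v).
split=> [x [xp xw]|x xg xd|v m va].
- exact: busemann_geodesic_semi_infinite l0 hlr r1 hb _ xp xw.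
- split; first by case: xg.
  exact: semi_infinite_geodesic_busemann l0 hlr r1 hb _ xg xd.
have [n0 _ hn0] := geodesic_prefix_busemann hb m va.
by exists n0 => n /hn0.
Qed.
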